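(* For $m,n,s,t=0,1,2,\dots$ and $\beta,\gamma>-1$, $$\int_{\mathbb R^2}M_{m,n}^{(\beta,\gamma)}(z,\bar z|q)\,\overline{M_{s,t}^{(\beta,\gamma)}(z,\bar z|q)}\;r^{2\beta}\,d\mu(r^2;\gamma|q)\,\frac{d\theta}{2\pi}=\zeta_{m\wedge n}(|m-n|+\beta,\gamma|q)\,\delta_{m,s}\,\delta_{n,t},\qquad z=re^{i\theta},$$ where $$d\mu(x;\gamma|q)=\sum_{k=0}^\infty\frac{(qx;q)_\infty\,x}{(q^{\gamma+1}x;q)_\infty}\,\delta(x-q^k),\qquad \zeta_n(\alpha,\gamma|q)=\frac{(q,q^{\alpha+\gamma+n+1};q)_\infty\,(q;q)_n\,q^{n(\alpha+1)}}{(q^{\alpha+1},q^{\gamma+n+1};q)_\infty\,(q^{\alpha+1};q)_n\,(1-q^{\alpha+\gamma+2n+1})}.$$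
   Context: $0<q<1$; $(a;q)_n=\prod_{k=0}^{n-1}(1-aq^k)$ (also for $n=\infty$), $(a,b;q)_n=(a;q)_n(b;q)_n$. The little $q$-Jacobi polynomials are $$p_n(x;q^\alpha,q^\gamma|q)=\frac{(q;q)_n}{q^{\binom n2}}\sum_{k=0}^n\frac{(q^{\alpha+\gamma+n+1};q)_{n-k}\,q^{\binom k2}(-x)^{n-k}}{(q;q)_k(q,q^{\alpha+1};q)_{n-k}}.$$ For $\beta,\gamma>-1$, $M^{(\beta,\gamma)}_{m,n}(z_1,z_2|q)=z_1^{m-n}p_n(z_1z_2;q^{\beta+m-n},q^\gamma|q)$ if $m\ge n$, and $M^{(\beta,\gamma)}_{m,n}(z_1,z_2|q)=M^{(\beta,\gamma)}_{n,m}(z_2,z_1|q)$ if $m<n$. $m\wedge n=\min\{m,n\}$; $\delta(x-q^k)$ is the unit point mass at $q^k$. The integral of $F(z)$ against $r^{2\beta}d\mu(r^2;\gamma|q)\frac{d\theta}{2\pi}$ means $\int_0^\infty\frac1{2\pi}\int_0^{2\pi}F(\sqrt x\,e^{i\theta})\,d\theta\,x^\beta d\mu(x;\gamma|q)$.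
   Formalization: When m = n = 0 and β+γ = −1 the printed ζ_0(β,γ|q) is 0/0; there the quotient (q^{β+γ+1};q)_∞/(1−q^{β+γ+1}) is read as its cancelled value (q^{β+γ+2};q)_∞ = (q;q)_∞. All other cases are as printed. *)

(* Defs.v *)
From HB Require Import structures.
From mathcomp Require Import all_boot all_order all_algebra.
From mathcomp Require Import all_classical all_reals all_analysis.
From mathcomp Require Import complex.

Set Implicit Arguments.
Unset Strict Implicit.
Unset Printing Implicit Defensive.

Import Order.TTheory GRing.Theory Num.Theory.
Import numFieldNormedType.Exports.

Local Open Scope classical_set_scope.
Local Open Scope ring_scope.

Section qPochhammer.
Variable R : realType.

Definition qpoch (a q : R) (n : nat) : R :=
  \prod_(0 <= k < n) (1 - a * q ^+ k).

Definition qpoch_inf (a q : R) : R := limn (qpoch a q).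

Lemma qpoch_inf_ge0 (a q : R) :
  0 <= a <= 1 -> 0 < q < 1 -> 0 <= qpoch_inf a q.
Proof.
move=> /andP[a0 a1] /andP[q0 q1].
have f01 k : 0 <= 1 - a * q ^+ k <= 1.
  rewrite subr_ge0 lerBlDr lerDl mulr_ge0 ?exprn_ge0 ?(ltW q0)// andbT.
  by rewrite mulr_ile1 ?exprn_ge0 ?exprn_ile1 ?(ltW q0) ?(ltW q1).
have p0 n : 0 <= qpoch a q n.
  by rewrite /qpoch; apply: prodr_ge0 => k _; case/andP: (f01 k).
apply: limr_ge; last by near=> n; exact: p0.
apply: nonincreasing_is_cvgn; last by exists 0 => _ [n _ <-]; exact: p0.
apply/nonincreasing_seqP => n; rewrite /qpoch big_nat_recr//=.
by rewrite ler_piMr//; [exact: p0|case/andP: (f01 n)].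
Unshelve. all: by end_near. Qed.

End qPochhammer.

Section polynomials.
Variable R : realType.
Local Open Scope complex_scope.

(* [little_qJacobi q n a c x] is p_n(x; q^a, q^c | q): the exponents, not the
   powers of q, are the arguments. *)
Definition little_qJacobi (q : R) (n : nat) (a c : R) (x : R[i]) : R[i] :=
  (qpoch q q n / q ^+ 'C(n, 2))%:C *
  \sum_(0 <= k < n.+1)
    (qpoch (q `^ (a + c + n%:R + 1)) q (n - k) * q ^+ 'C(k, 2) /
     (qpoch q q k * (qpoch q q (n - k) * qpoch (q `^ (a + 1)) q (n - k))))%:C
    * (- x) ^+ (n - k).

Definition disc_poly_ge (q b c : R) (m n : nat) (z1 z2 : R[i]) : R[i] :=
  z1 ^+ (m - n) * little_qJacobi q n (b + (m - n)%:R) c (z1 * z2).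

(* M_{m,n}^{(b,c)}(z1, z2 | q) *)
Definition disc_poly (q b c : R) (m n : nat) (z1 z2 : R[i]) : R[i] :=
  if (n <= m)%N then disc_poly_ge q b c m n z1 z2
  else disc_poly_ge q b c n m z2 z1.

End polynomials.

Section radial_measure.
Variable R : realType.

Definition radial_weight (q c x : R) : R :=
  qpoch_inf (q * x) q * x / qpoch_inf (q `^ (c + 1) * x) q.

Lemma radial_weight_ge0 (q c : R) (hq : 0 < q < 1) (hc : -1 < c) (k : nat) :
  0 <= radial_weight q c (q ^+ k).
Proof.
have /andP[q0 q1] := hq.
have qk1 : q ^+ k <= 1 by rewrite exprn_ile1 ?(ltW q0) ?(ltW q1).
rewrite /radial_weight divr_ge0 ?mulr_ge0 ?exprn_ge0 ?(ltW q0)//.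
  apply: qpoch_inf_ge0 => //.
  by rewrite mulr_ge0 ?mulr_ile1 ?exprn_ge0 ?(ltW q0) ?(ltW q1).
apply: qpoch_inf_ge0 => //.
have c1 : 0 <= c + 1 by rewrite -lerBlDr sub0r ltW.
have qc1 : q `^ (c + 1) <= 1.
  by rewrite -[leRHS](powRr0 q) ger_powR// q0 ltW.
by rewrite mulr_ge0 ?mulr_ile1 ?powR_ge0 ?exprn_ge0 ?(ltW q0).
Qed.

(* mu(.; c | q), the sum of point masses [radial_weight q c (q^k)] at q^k *)
Definition radial_measure (q c : R) (hq : 0 < q < 1) (hc : -1 < c) :
    {measure set (measurableTypeR R) -> \bar R} :=
  mseries (fun k => mscale (NngNum (radial_weight_ge0 hq hc k))
                           (\d_(q ^+ k : measurableTypeR R))) 0.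

End radial_measure.

Section complex_integration.
Context (d : measure_display) (T : measurableType d) (R : realType).
Variables (mu : {measure set T -> \bar R}) (D : set T).
Local Open Scope complex_scope.

Definition cintegrable (f : T -> R[i]) : Prop :=
  mu.-integrable D (fun x => (complex.Re (f x))%:E) /\
  mu.-integrable D (fun x => (complex.Im (f x))%:E).

Definition cintegral (f : T -> R[i]) : R[i] :=
  Rintegral mu D (fun x => complex.Re (f x)) +i*
  Rintegral mu D (fun x => complex.Im (f x)).

End complex_integration.

Section polar_integration.
Variable R : realType.
Local Open Scope complex_scope.

Definition cis (theta : R) : R[i] := cos theta +i* sin theta.

Definition angular_mean (F : R[i] -> R[i]) (r : R) : R[i] :=
  ((2 * pi)^-1)%:C *
  cintegral (@lebesgue_measure R) `[0, 2 * pi]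
    (fun theta => F (r%:C * cis theta)).

Variables (mu : {measure set (measurableTypeR R) -> \bar R}) (b : R).

(* Integration against r^(2b) dmu(r^2) dtheta/(2 pi), with x = r^2. *)
Definition polar_integrable (F : R[i] -> R[i]) : Prop :=
  (forall x : R, 0 < x ->
     cintegrable (@lebesgue_measure R) `[0, 2 * pi]
       (fun theta => F ((Num.sqrt x)%:C * cis theta))) /\
  cintegrable mu `]0, +oo[
    (fun x => angular_mean F (Num.sqrt x) * (x `^ b)%:C).

Definition polar_integral (F : R[i] -> R[i]) : R[i] :=
  cintegral mu `]0, +oo[
    (fun x => angular_mean F (Num.sqrt x) * (x `^ b)%:C).

End polar_integration.

Section zeta.
Variable R : realType.

(* (q^(a+c+n+1); q)_oo / (1 - q^(a+c+2n+1)).  The denominator is the factor of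
   index n of the numerator; when it vanishes (for a, c > -1 this happens only
   if n = 0 and a + c = -1) the quotient is 0/0 and stands for the product of
   the remaining factors, which is its continuous extension. *)
Definition zeta_quotient (q : R) (n : nat) (a c : R) : R :=
  if a + c + 2 * n%:R + 1 == 0 then
    qpoch (q `^ (a + c + n%:R + 1)) q n *
    qpoch_inf (q `^ (a + c + 2 * n%:R + 2)) q
  else
    qpoch_inf (q `^ (a + c + n%:R + 1)) q / (1 - q `^ (a + c + 2 * n%:R + 1)).

Definition zeta (q : R) (n : nat) (a c : R) : R :=
  qpoch_inf q q * zeta_quotient q n a c * qpoch q q n * q `^ (n%:R * (a + 1)) /
  (qpoch_inf (q `^ (a + 1)) q * qpoch_inf (q `^ (c + n%:R + 1)) q *
   qpoch (q `^ (a + 1)) q n).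

End zeta.

(* Main.v *)
Require Import Defs.
From mathcomp Require Import all_boot all_order all_algebra.
From mathcomp Require Import all_classical all_reals all_analysis.
From mathcomp Require Import complex.
From mathcomp Require Import ring lra zify measurable_realfun.

Import Order.TTheory GRing.Theory Num.Theory.
Import numFieldNormedType.Exports.
Local Open Scope ring_scope.
Local Open Scope classical_set_scope.

(** In polar coordinates [M_{m,n}(z, conj z)] is
    [r^|m-n| e^{i(m-n)theta} P(r^2)], with [P] the real little q-Jacobi
    polynomial of degree [min(m,n)] and parameters [|m-n| + beta, gamma].  The
    angular integral of the product is therefore a Fourier coefficient: it
    vanishes unless [m - n = s - t], and then the two polynomials in play
    belong to one and the same orthogonal family.

    What remains is the orthogonality of that family for the functional
    [L(p) = sum_k mass_k a^k p(q^k)], with [a = q^(alpha+1)] and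
    [g = q^(gamma+1)].  Only [L(p_n phi_i)] is computed, where [p_n] is
    expanded in powers of [x] but the test polynomial is
    [phi_i(x) = (g x; q)_i].  Multiplying by [phi_i] turns the mass with
    parameter [g] into the one with parameter [g q^i] ([mass_shift]), so each
    [L(x^j phi_i)] is a single sum evaluated by the q-binomial theorem
    ([q_binomial]).  The resulting finite sum over [j] is of
    q-Chu-Vandermonde type ([q_chu_vandermonde]) and factors as
    [prod_{k<n} (d - a g q^(i+k))], where [d = a g q^(n-1)].  For [i < n] one
    factor is zero, and the [phi_i] span the polynomials of each degree, so
    [p_n] is orthogonal to all polynomials of lower degree.  For [i = n] the
    product gives [L(p_n phi_n)], hence the norm [L(p_n p_n)] after comparing
    the leading coefficients of [p_n] and [phi_n]. *)

(** * Finite q-shifted factorials *)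

Lemma sqrn_bin2 n : (n * n = 'C(n, 2) + 'C(n, 2) + n)%N.
Proof. by elim: n => // n IHn; rewrite binS bin1; lia. Qed.

Section finite.
Context {R : realType}.
Implicit Types (a q : R) (n : nat).

Lemma qpoch0 a q : qpoch a q 0 = 1.
Proof. by rewrite /qpoch big_geq. Qed.

Lemma qpochSr a q n : qpoch a q n.+1 = qpoch a q n * (1 - a * q ^+ n).
Proof. by rewrite /qpoch big_nat_recr. Qed.

Lemma qpochD a q m n : qpoch a q (m + n) = qpoch a q m * qpoch (a * q ^+ m) q n.
Proof.
elim: n => [|n IHn]; first by rewrite addn0 qpoch0 mulr1.
by rewrite addnS !qpochSr IHn -!mulrA exprD !mulrA.
Qed.

Lemma qpochSl a q n : qpoch a q n.+1 = (1 - a) * qpoch (a * q) q n.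
Proof. by rewrite -add1n qpochD qpochSr qpoch0 expr0 expr1 mul1r mulr1. Qed.

Lemma qpoch_gt0 a q n : 0 < q < 1 -> 0 <= a < 1 -> 0 < qpoch a q n.
Proof.
move=> /andP[q0 q1] /andP[a0 a1]; rewrite /qpoch prodr_gt0// => k _.
rewrite subr_gt0 (le_lt_trans _ a1)// ler_piMr// exprn_ile1// ltW//.
Qed.

(** The q-Chu-Vandermonde sum, cleared of denominators in [b] and [c] so that
    it holds for all values of both.  Induction on [n]: multiply the sum by
    [1 - q^(n+1) = (1 - q^j) + q^j (1 - q^(n+1-j))]; each of the two terms
    cancels the last factor of one of the two denominators, which is the
    q-Pascal rule without q-binomial coefficients. *)
Lemma q_chu_vandermonde q n (b c : R) : 0 < q < 1 ->
  \sum_(j < n.+1) (-1) ^+ j * q ^+ 'C(n - j, 2) * qpoch b q j *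
     qpoch (c * q ^+ j) q (n - j) / (qpoch q q j * qpoch q q (n - j)) =
  q ^+ 'C(n, 2) * (\prod_(k < n) (b - c * q ^+ k)) / qpoch q q n.
Proof.
move=> hq; have /andP[q0 q1] := hq.
have qn0 k : qpoch q q k != 0 by rewrite gt_eqF// qpoch_gt0// q1 ltW.
have qk0 k : 1 - q * q ^+ k != 0.
  by rewrite -exprS subr_eq0 gt_eqF// exprn_ilt1// ltW.
elim: n b c => [|n IHn] b c.
  by rewrite big_ord1 big_ord0 !qpoch0 !expr0 !mulr1 divr1.
pose t (j : nat) := (-1) ^+ j * q ^+ 'C(n.+1 - j, 2) * qpoch b q j *
     qpoch (c * q ^+ j) q (n.+1 - j) / (qpoch q q j * qpoch q q (n.+1 - j)).
have split_t : (1 - q ^+ n.+1) * \sum_(j < n.+2) t j =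
    \sum_(j < n.+2) (1 - q ^+ j) * t j
    + \sum_(j < n.+2) q ^+ j * (1 - q ^+ (n.+1 - j)) * t j.
  rewrite mulr_sumr -big_split; apply: eq_bigr => j _ /=.
  have jn : (j <= n.+1)%N by rewrite -ltnS.
  by rewrite -{1}(subnKC jn) exprD; ring.
have low : \sum_(j < n.+2) (1 - q ^+ j) * t j =
    - (1 - b) * (q ^+ 'C(n, 2) * (\prod_(k < n) (b * q - c * q * q ^+ k)) /
        qpoch q q n).
  rewrite -IHn big_ord_recl expr0 subrr mul0r add0r mulr_sumr.
  apply: eq_bigr => j _; rewrite /t lift0 subSS.
  have -> : c * q ^+ j.+1 = c * q * q ^+ j by rewrite exprS mulrA.
  rewrite qpochSl (qpochSr q) !exprS; field.
  by rewrite !qn0 qk0.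
have high : \sum_(j < n.+2) q ^+ j * (1 - q ^+ (n.+1 - j)) * t j =
    q ^+ n * (1 - c * q ^+ n) *
    (q ^+ 'C(n, 2) * (\prod_(k < n) (b - c * q ^+ k)) / qpoch q q n).
  rewrite -IHn big_ord_recr /= subnn expr0 subrr mulr0 mul0r addr0 mulr_sumr.
  apply: eq_bigr => j _.
  have jn : (j <= n)%N by rewrite -ltnS.
  rewrite /t subSn// binS bin1 !qpochSr exprD !exprS.
  have -> : q ^+ n = q ^+ j * q ^+ (n - j) by rewrite -exprD subnKC.
  field.
  by rewrite !qn0 qk0.
apply: (mulfI (x := 1 - q ^+ n.+1)); first by rewrite exprS qk0.
rewrite split_t low high binS bin1 big_ord_recr /= exprD qpochSr.
have -> : \prod_(k < n) (b * q - c * q * q ^+ k) =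
    q ^+ n * \prod_(k < n) (b - c * q ^+ k).
  rewrite -[in q ^+ n](card_ord n) -prodr_const -big_split /=.
  by apply: eq_bigr => k _; ring.
rewrite exprS; field.
by rewrite qn0 qk0.
Qed.

End finite.

(** * Infinite q-shifted factorials *)

Section infinite.
Context {R : realType}.
Variable q : R.
Hypothesis hq : 0 < q < 1.
Implicit Types (a z : R) (n : nat).

Let q0 : 0 < q. Proof. by case/andP: hq. Qed.
Let q1 : q < 1. Proof. by case/andP: hq. Qed.

Lemma qpoch_decreasing a : 0 <= a < 1 ->
  {homo qpoch a q : n m / (n <= m)%N >-> m <= n}.
Proof.
move=> a01; apply/nonincreasing_seqP => n; rewrite qpochSr.
rewrite ler_piMr//; first by rewrite ltW// qpoch_gt0.
by rewrite lerBlDr lerDl mulr_ge0 ?exprn_ge0 ?(ltW q0)//; case/andP: a01.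
Qed.

Lemma is_cvg_qpoch a : 0 <= a < 1 -> cvgn (qpoch a q).
Proof.
move=> a01; apply: nonincreasing_is_cvgn; first exact: qpoch_decreasing.
by exists 0 => _ [n _ <-]; rewrite ltW ?qpoch_gt0.
Qed.

Lemma cvg_qpoch a : 0 <= a < 1 -> qpoch a q n @[n --> \oo] --> qpoch_inf a q.
Proof. exact: is_cvg_qpoch. Qed.

Lemma qpoch_infD a n : 0 <= a * q ^+ n < 1 ->
  qpoch_inf a q = qpoch a q n * qpoch_inf (a * q ^+ n) q.
Proof.
move=> a01; apply/cvg_lim => //; rewrite -(cvg_shiftn n).
under eq_fun do rewrite addnC qpochD.
by apply: cvgMl_tmp; exact: cvg_qpoch.
Qed.

Lemma qpoch_ge_1B a n : 0 <= a < 1 ->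
  1 - a * (1 - q ^+ n) / (1 - q) <= qpoch a q n.
Proof.
move=> /andP[a0 a1]; have q1n : 1 - q != 0 by rewrite subr_eq0 gt_eqF.
elim: n => [|n IHn]; first by rewrite expr0 subrr mulr0 mul0r subr0 qpoch0.
have P1 : qpoch a q n <= 1.
  by rewrite -(qpoch0 a q) qpoch_decreasing ?a0.
have an0 : 0 <= a * q ^+ n by rewrite mulr_ge0// exprn_ge0// ltW.
rewrite qpochSr.
have -> : 1 - a * (1 - q ^+ n.+1) / (1 - q) =
    1 - a * (1 - q ^+ n) / (1 - q) - a * q ^+ n by rewrite exprS; field.
by rewrite [leRHS]mulrBr mulr1; apply: lerB => //; rewrite ler_piMl.
Qed.

(** Every tail of the product is at least [1] minus the sum of its terms, and
    that sum is small for a late enough tail. *)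
Lemma qpoch_inf_gt0 a : 0 <= a < 1 -> 0 < qpoch_inf a q.
Proof.
move=> /andP[a0 a1].
(* From N on, the sum of the terms a q^k is at most 1/2. *)
have [N aN] : exists N, a * q ^+ N <= (1 - q) / 2.
  have : geometric a q n @[n --> \oo] --> (0 : R).
    by apply: cvg_geometric; rewrite ger0_norm// ltW.
  have e0 : 0 < (1 - q) / 2 by rewrite divr_gt0// subr_gt0.
  move=> /cvgrPdist_le /(_ _ e0)[N _ /(_ N (leqnn N))].
  rewrite sub0r normrN /geometric /= ger0_norm ?mulr_ge0 ?exprn_ge0 ?(ltW q0)//.
  by move=> aN; exists N.
have aN01 : 0 <= a * q ^+ N < 1.
  rewrite mulr_ge0 ?exprn_ge0 ?(ltW q0)//= (le_lt_trans aN)//.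
  by have := q0; lra.
rewrite (qpoch_infD a N)// mulr_gt0 ?qpoch_gt0 ?a0//.
apply: (@lt_le_trans _ _ (1 / 2)); first by rewrite divr_gt0.
apply: limr_ge; first exact: is_cvg_qpoch.
apply: nearW => n; apply: le_trans (qpoch_ge_1B _ n aN01).
suff : a * q ^+ N * (1 - q ^+ n) / (1 - q) <= 1 / 2 by lra.
rewrite ler_pdivrMr ?subr_gt0// mulrAC mul1r -[leRHS]mulr1 mulrAC.
rewrite mulrC [leRHS]mulrC.
case/andP: aN01 => ? _; apply: ler_pM => //.
- by rewrite subr_ge0 exprn_ile1 ?(ltW q0) ?(ltW q1).
- by rewrite lerBlDr lerDl exprn_ge0// ltW.
- by rewrite (le_trans aN)// mulrC.
Qed.

End infinite.

(** * The q-binomial theorem *)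

Section q_binomial.
Context {R : realType}.
Variables (q a : R).
Hypotheses (hq : 0 < q < 1) (a01 : 0 <= a < 1).

Let q0 : 0 < q. Proof. by case/andP: hq. Qed.
Let q1 : q < 1. Proof. by case/andP: hq. Qed.
Let q01 : 0 <= q < 1. Proof. by rewrite q1 ltW. Qed.

Definition qbin_coef (k : nat) : R := qpoch a q k / qpoch q q k.

Lemma qbin_coef_gt0 k : 0 < qbin_coef k.
Proof. by rewrite divr_gt0 ?qpoch_gt0. Qed.

Lemma qbin_coef_ge0 k : 0 <= qbin_coef k.
Proof. by rewrite ltW// qbin_coef_gt0. Qed.

Lemma qbin_coefS k :
  qbin_coef k.+1 * (1 - q ^+ k.+1) = qbin_coef k * (1 - a * q ^+ k).
Proof.
have qk : 1 - q * q ^+ k != 0.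
  by rewrite -exprS subr_eq0 gt_eqF// exprn_ilt1// ltW.
have qp : qpoch q q k != 0 by rewrite gt_eqF// qpoch_gt0.
by rewrite /qbin_coef !qpochSr exprS; field; rewrite qp qk.
Qed.

Lemma qbin_coef_le k : qbin_coef k <= (qpoch_inf q q)^-1.
Proof.
rewrite /qbin_coef -[leRHS]mul1r; apply: ler_pM.
- by rewrite ltW// qpoch_gt0.
- by rewrite invr_ge0 ltW// qpoch_gt0.
- by rewrite -(qpoch0 a q); exact: qpoch_decreasing.
rewrite lef_pV2 ?posrE ?qpoch_gt0 ?qpoch_inf_gt0//.
by apply: nonincreasing_cvgn_ge; [exact: qpoch_decreasing|exact: is_cvg_qpoch].
Qed.

Definition qbin_series (z : R) : R :=
  limn (series (fun k => qbin_coef k * z ^+ k)).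

Lemma is_cvg_qbin_series (z : R) : 0 <= z < 1 ->
  cvgn (series (fun k => qbin_coef k * z ^+ k)).
Proof.
move=> /andP[z0 z1].
apply: (series_le_cvg (v_ := geometric (qpoch_inf q q)^-1 z)) => [k|k|k|].
- by rewrite mulr_ge0 ?qbin_coef_ge0 ?exprn_ge0//.
- by rewrite /geometric /= mulr_ge0 ?exprn_ge0// invr_ge0 ltW ?qpoch_inf_gt0.
- by rewrite /geometric /= ler_wpM2r ?exprn_ge0 ?qbin_coef_le.
- by apply: is_cvg_geometric_series; rewrite ger0_norm.
Qed.

Lemma cvg_qbin_series (z : R) : 0 <= z < 1 ->
  series (fun k => qbin_coef k * z ^+ k) n @[n --> \oo] --> qbin_series z.
Proof. exact: is_cvg_qbin_series. Qed.

(** Dividing by [1 - z] and iterating pushes the argument of the series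
    to [0]. *)
Lemma qbin_series_eq (z : R) : 0 <= z < 1 ->
  (1 - z) * qbin_series z = (1 - a * z) * qbin_series (q * z).
Proof.
move=> z01; have /andP[z0 z1] := z01.
have qz01 : 0 <= q * z < 1.
  by rewrite mulr_ge0 ?(ltW q0)//= (le_lt_trans _ z1)// ler_piMl// ltW.
suff : qbin_series z - qbin_series (q * z) =
       z * (qbin_series z - a * qbin_series (q * z)) by move=> H; lra.
pose S := series (fun k => qbin_coef k * z ^+ k).
pose S' := series (fun k => qbin_coef k * (q * z) ^+ k).
have telescope n : S n.+1 - S' n.+1 = z * (S n - a * S' n).
  rewrite /S /S' /series /= !big_mkord -sumrB mulr_sumr -sumrB mulr_sumr.
  rewrite big_ord_recl !expr0 subrr add0r; apply: eq_bigr => k _.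
  rewrite lift0 !exprMn.
  have := qbin_coefS k; rewrite exprS => H.
  rewrite [LHS](_ : _ = qbin_coef k.+1 * (1 - q * q ^+ k) * z ^+ k.+1).
    by rewrite H exprS; ring.
  by rewrite !exprS; ring.
transitivity (limn (fun n => S n.+1 - S' n.+1)).
  apply/esym/cvg_lim => //; rewrite (cvg_shiftS (fun n => S n - S' n)).
  by apply: cvgB; exact: cvg_qbin_series.
under eq_fun do rewrite telescope.
apply/cvg_lim => //.
apply: cvgMl_tmp; apply: cvgB; first exact: cvg_qbin_series.
by apply: cvgMl_tmp; exact: cvg_qbin_series.
Qed.

Lemma qbin_series_iter (z : R) n : 0 <= z < 1 ->
  qpoch z q n * qbin_series z = qpoch (a * z) q n * qbin_series (z * q ^+ n).
Proof.
move=> z01; have /andP[z0 z1] := z01.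
elim: n => [|n IHn]; first by rewrite !qpoch0 expr0 mulr1.
have zn01 : 0 <= z * q ^+ n < 1.
  rewrite mulr_ge0 ?exprn_ge0 ?(ltW q0)//= (le_lt_trans _ z1)//.
  by rewrite ler_piMr// exprn_ile1// ltW.
rewrite !qpochSr mulrAC IHn.
have := qbin_series_eq _ zn01.
have -> : q * (z * q ^+ n) = z * q ^+ n.+1 by rewrite exprS; ring.
by move=> H; rewrite -[LHS]mulrA [_ * (1 - _)]mulrC H; ring.
Qed.

(** Iterating [qbin_series_eq] leaves the factor [qbin_series (z q^n)], which
    tends to [1]: the coefficients are nonnegative, so its terms of positive
    degree add up to at most [q^n (qbin_series z - 1)]. *)
Lemma q_binomial (z : R) : 0 <= z < 1 ->
  qbin_series z = qpoch_inf (a * z) q / qpoch_inf z q.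
Proof.
move=> z01; have /andP[z0 z1] := z01; have /andP[a0 a1] := a01.
have az01 : 0 <= a * z < 1.
  by rewrite mulr_ge0//= (le_lt_trans _ z1)// ler_piMl// ltW.
have zn01 n : 0 <= z * q ^+ n < 1.
  rewrite mulr_ge0 ?exprn_ge0 ?(ltW q0)//= (le_lt_trans _ z1)//.
  by rewrite ler_piMr// exprn_ile1// ltW.
pose g (y : R) := series (fun k => qbin_coef k * y ^+ k).
have g1 y : g y 1%N = 1.
  by rewrite /g /series /= big_nat1 /qbin_coef !qpoch0 expr0 divr1 mulr1.
have lower n : 1 <= qbin_series (z * q ^+ n).
  rewrite -[leLHS](g1 (z * q ^+ n)).
  apply: nondecreasing_cvgn_le; last exact: is_cvg_qbin_series.
  apply: nondecreasing_series => k _ _.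
  by case/andP: (zn01 n) => ? ?; rewrite mulr_ge0 ?qbin_coef_ge0 ?exprn_ge0//.
have upper n :
    qbin_series (z * q ^+ n) <= 1 + geometric (qbin_series z - 1) q n.
  apply: limr_le; first exact: is_cvg_qbin_series.
  near=> m; have m0 : (0 < m)%N by near: m; exact: nbhs_infty_gt.
  have zm : g z m <= qbin_series z.
    apply: nondecreasing_cvgn_le; last exact: is_cvg_qbin_series.
    apply: nondecreasing_series => k _ _.
    by rewrite mulr_ge0 ?qbin_coef_ge0 ?exprn_ge0//.
  apply: (@le_trans _ _ (1 + q ^+ n * (g z m - 1))); last first.
    rewrite lerD2l /geometric /= mulrC ler_wpM2r ?exprn_ge0 ?(ltW q0)//.
    exact: lerB.
  rewrite -(prednK m0) -{1}(g1 (z * q ^+ n)) -(g1 z) /g /series /=.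
  rewrite !(@big_cat_nat _ _ _ 1 0 m.-1.+1)//= addrAC subrr add0r lerD2l.
  rewrite mulr_sumr !big_nat; apply: ler_sum => k /andP[k1 _].
  rewrite exprMn [leLHS]mulrA [leRHS]mulrC; apply: ler_wpM2l.
    by rewrite mulr_ge0 ?qbin_coef_ge0 ?exprn_ge0//.
  rewrite -exprM ler_wiXn2l ?(ltW q0) ?(ltW q1)//.
  by rewrite leq_pmulr.
have tail : qbin_series (z * q ^+ n) @[n --> \oo] --> (1 : R).
  apply: (squeeze_cvgr (f := fun=> 1 : R)
    (h := fun n => 1 + geometric (qbin_series z - 1) q n)).
  - by apply: nearW => n; rewrite lower upper.
  - exact: cvg_cst.
  - rewrite -[X in _ --> X]addr0; apply: cvgD; first exact: cvg_cst.
    by apply: cvg_geometric; rewrite ger0_norm// ltW.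
have zinf : qpoch_inf z q != 0 by rewrite gt_eqF// qpoch_inf_gt0.
apply: (mulfI zinf); rewrite mulrCA divff// mulr1.
transitivity (limn (fun n => qpoch z q n * qbin_series z)).
  by apply/esym/cvg_lim => //; apply: cvgMr_tmp; exact: cvg_qpoch.
under eq_fun do rewrite qbin_series_iter//.
rewrite -[RHS]mulr1; apply/cvg_lim => //.
by apply: cvgM => //; exact: cvg_qpoch.
Unshelve. all: by end_near. Qed.

End q_binomial.

(** * Orthogonality of the little q-Jacobi polynomials *)

Section jackson.
Context {R : realType}.
Variable q : R.
Hypothesis hq : 0 < q < 1.

Let q0 : 0 < q. Proof. by case/andP: hq. Qed.
Let q1 : q < 1. Proof. by case/andP: hq. Qed.
Let q01 : 0 <= q < 1. Proof. by rewrite q1 ltW. Qed.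

Lemma scaled_expr_lt1 (x : R) (k : nat) : 0 <= x < 1 -> 0 <= x * q ^+ k < 1.
Proof.
move=> /andP[x0 x1]; rewrite mulr_ge0 ?exprn_ge0 ?(ltW q0)//=.
by rewrite (le_lt_trans _ x1)// ler_piMr// exprn_ile1// ltW.
Qed.

Lemma mul_lt1 (x y : R) : 0 <= x < 1 -> 0 <= y < 1 -> 0 <= x * y < 1.
Proof.
move=> /andP[x0 x1] /andP[y0 y1]; rewrite mulr_ge0//=.
by rewrite (le_lt_trans _ x1)// ler_piMr// ltW.
Qed.

(** The mass that the radial measure of parameter [g = q^(gamma+1)] puts
    at [q^k], divided by [q^k]; that factor is absorbed in the [a^k] of
    [jackson_term]. *)
Definition mass (g : R) (k : nat) : R :=
  qpoch_inf (q * q ^+ k) q / qpoch_inf (g * q ^+ k) q.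

Lemma mass_ge0 g k : 0 <= g < 1 -> 0 <= mass g k.
Proof.
by move=> g01; rewrite divr_ge0// ltW// qpoch_inf_gt0// scaled_expr_lt1.
Qed.

Lemma massE g k : 0 <= g < 1 ->
  mass g k = qpoch_inf q q / qpoch_inf g q * qbin_coef q g k.
Proof.
move=> g01; rewrite /mass /qbin_coef.
rewrite (qpoch_infD q hq q k) ?scaled_expr_lt1//.
rewrite (qpoch_infD q hq g k) ?scaled_expr_lt1//.
have nz1 : qpoch_inf (g * q ^+ k) q != 0.
  by rewrite gt_eqF// qpoch_inf_gt0// scaled_expr_lt1.
have nz2 : qpoch g q k != 0 by rewrite gt_eqF// qpoch_gt0.
have nz3 : qpoch q q k != 0 by rewrite gt_eqF// qpoch_gt0.
by field; rewrite nz1 nz2 nz3.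
Qed.

(** This is why [(g x; q)_i] is the right test polynomial: it cancels the
    first [i] factors of the denominator of the mass. *)
Lemma mass_shift g i k : 0 <= g < 1 ->
  mass g k * qpoch (g * q ^+ k) q i = mass (g * q ^+ i) k.
Proof.
move=> g01; rewrite /mass.
rewrite (qpoch_infD q hq (g * q ^+ k) i) ?scaled_expr_lt1//.
rewrite [g * q ^+ i * _]mulrAC.
have nz1 : qpoch_inf (g * q ^+ k * q ^+ i) q != 0.
  by rewrite gt_eqF// qpoch_inf_gt0// !scaled_expr_lt1.
have nz2 : qpoch (g * q ^+ k) q i != 0.
  by rewrite gt_eqF// qpoch_gt0// scaled_expr_lt1.
by field; rewrite nz1 nz2.
Qed.

Lemma cvg_mass_series g z : 0 <= g < 1 -> 0 <= z < 1 ->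
  series (fun k => mass g k * z ^+ k) n @[n --> \oo] -->
  qpoch_inf q q / qpoch_inf g q * (qpoch_inf (g * z) q / qpoch_inf z q).
Proof.
move=> g01 z01.
under [X in series X]eq_fun do rewrite massE// -mulrA.
rewrite -q_binomial//.
under eq_fun do rewrite /series /= -mulr_sumr.
by apply: cvgMl_tmp; exact: cvg_qbin_series.
Qed.

Section functional.
Variables (a g : R).
Hypotheses (a01 : 0 < a < 1) (g01 : 0 < g < 1).

Let a_lt1 : 0 <= a < 1. Proof. by case/andP: a01 => /ltW -> ->. Qed.
Let g_lt1 : 0 <= g < 1. Proof. by case/andP: g01 => /ltW -> ->. Qed.
Let ag_lt1 : 0 <= a * g < 1. Proof. exact: mul_lt1. Qed.

Definition jackson_term (p : {poly R}) (k : nat) : R :=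
  mass g k * a ^+ k * p.[q ^+ k].
Definition jackson_sum (p : {poly R}) : R := limn (series (jackson_term p)).

Lemma horner_le_norm (p : {poly R}) (x : R) : 0 <= x <= 1 ->
  `|p.[x]| <= \sum_(j < size p) `|p`_j|.
Proof.
move=> /andP[x0 x1]; rewrite horner_coef (le_trans (ler_norm_sum _ _ _))//.
apply: ler_sum => j _; rewrite normrM ler_piMr// ger0_norm ?exprn_ge0//.
by rewrite exprn_ile1.
Qed.

(** A polynomial is bounded on [[0, 1]], so it is enough that the masses
    themselves are summable. *)
Lemma is_cvg_norm_jackson_term p : cvgn (series (fun k => `|jackson_term p k|)).
Proof.
pose M := \sum_(j < size p) `|p`_j|.
have M0 : 0 <= M by rewrite sumr_ge0.
have ak k : 0 <= mass g k * a ^+ k.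
  by rewrite mulr_ge0 ?mass_ge0 ?exprn_ge0//; case/andP: a_lt1.
apply: (series_le_cvg (v_ := M *: (fun k => mass g k * a ^+ k))) => [//|k|k|].
- by rewrite mulr_ge0 ?ak.
- rewrite /jackson_term normrM ger0_norm ?ak// mulrC ler_wpM2r ?ak//.
  by rewrite horner_le_norm// exprn_ge0 ?exprn_ile1 ?(ltW q0) ?(ltW q1).
- by apply: is_cvg_seriesZ; apply/cvg_ex; eexists; exact: cvg_mass_series.
Qed.

Lemma is_cvg_jackson_term p : cvgn (series (jackson_term p)).
Proof. exact/normed_cvg/is_cvg_norm_jackson_term. Qed.

Lemma jackson_sumD p1 p2 :
  jackson_sum (p1 + p2) = jackson_sum p1 + jackson_sum p2.
Proof.
rewrite /jackson_sum -lim_seriesD; [|exact: is_cvg_jackson_term..].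
congr (limn (series _)); apply/funext => k.
by rewrite /jackson_term hornerD /= mulrDr.
Qed.

Lemma jackson_sumZ c p : jackson_sum (c *: p) = c * jackson_sum p.
Proof.
rewrite /jackson_sum -[RHS]lim_seriesZ; last exact: is_cvg_jackson_term.
congr (limn (series _)); apply/funext => k.
by rewrite /jackson_term hornerZ /= mulrCA.
Qed.

Lemma jackson_sum0 : jackson_sum 0 = 0.
Proof. by rewrite -(scale0r 0) jackson_sumZ mul0r. Qed.

(** The test polynomials [phi_i(x) = (g x; q)_i], chosen for [mass_shift]. *)
Definition shifted_basis (i : nat) : {poly R} :=
  \prod_(k < i) (1 - (g * q ^+ k) *: 'X).

Lemma horner_shifted_basis i x : (shifted_basis i).[x] = qpoch (g * x) q i.
Proof.
rewrite /shifted_basis /qpoch horner_prod big_mkord; apply: eq_bigr => k _.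
by rewrite !hornerE mulrAC.
Qed.

Lemma size_shifted_basis i : (size (shifted_basis i) <= i.+1)%N.
Proof.
rewrite /shifted_basis; elim: i => [|i IHi].
  by rewrite big_ord0 size_poly1.
rewrite big_ord_recr /= (leq_trans (size_polyMleq _ _))//.
apply: (@leq_trans (size (\prod_(k < i) (1 - (g * q ^+ k) *: 'X)) + 1));
  last by rewrite addn1.
rewrite -subn1 leq_subLR addnCA leq_add2l.
rewrite (leq_trans (size_polyD _ _))// geq_max size_poly1 size_polyN.
by rewrite (leq_trans (size_scale_leq _ _))// size_polyX.
Qed.

Lemma coef_shifted_basis i :
  (shifted_basis i)`_i = (- g) ^+ i * q ^+ 'C(i, 2).
Proof.
elim: i => [|i IHi].
  by rewrite /shifted_basis big_ord0 coef1 !expr0 mulr1.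
have := size_shifted_basis i.
rewrite /shifted_basis big_ord_recr /= -/(shifted_basis i) => sz.
rewrite mulrBr mulr1 coefB nth_default// sub0r -scalerAr coefZ coefMX /= IHi.
by rewrite exprS binS bin1 exprD; ring.
Qed.

Lemma coef_shifted_basis_neq0 i : (shifted_basis i)`_i != 0.
Proof.
have /andP[g0 _] := g01.
by rewrite coef_shifted_basis mulf_neq0// expf_neq0// ?oppr_eq0 gt_eqF.
Qed.

(** One step of the expansion of a polynomial in the basis [phi_i]. *)
Lemma size_sub_shifted_basis m (r : {poly R}) : (size r <= m.+1)%N ->
  (size (r - (r`_m / (shifted_basis m)`_m) *: shifted_basis m)%R <= m)%N.
Proof.
move=> sr; apply/leq_sizeP => j; rewrite leq_eqVlt => /predU1P[<-|mj].
  by rewrite coefB coefZ divfK ?subrr// coef_shifted_basis_neq0.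
rewrite coefB coefZ (nth_default 0 (leq_trans sr mj)).
by rewrite (nth_default 0 (leq_trans (size_shifted_basis m) mj)) mulr0 subrr.
Qed.

(** The value of [jackson_sum] at [shifted_basis i], that is the case [j = 0] of
    [jackson_sum_moment]. *)
Definition moment_const (i : nat) : R :=
  qpoch_inf q q * qpoch_inf (a * g * q ^+ i) q /
  (qpoch_inf (g * q ^+ i) q * qpoch_inf a q).

Lemma jackson_sum_moment i j : jackson_sum ('X^j * shifted_basis i) =
  moment_const i * qpoch a q j / qpoch (a * g * q ^+ i) q j.
Proof.
have agi : 0 <= a * g * q ^+ i < 1 by rewrite scaled_expr_lt1.
rewrite /jackson_sum.
have -> : jackson_term ('X^j * shifted_basis i) =
          (fun k => mass (g * q ^+ i) k * (a * q ^+ j) ^+ k).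
  apply/funext => k; rewrite -mass_shift// /jackson_term hornerM hornerXn.
  by rewrite horner_shifted_basis exprMn -!exprM mulnC; ring.
have lim_mass := @cvg_mass_series (g * q ^+ i) (a * q ^+ j)
  (scaled_expr_lt1 _ _ g_lt1) (scaled_expr_lt1 _ _ a_lt1).
rewrite (cvg_lim _ lim_mass)//.
rewrite /moment_const (qpoch_infD q hq a j) ?scaled_expr_lt1//.
rewrite (qpoch_infD q hq (a * g * q ^+ i) j) ?scaled_expr_lt1//.
have -> : g * q ^+ i * (a * q ^+ j) = a * g * q ^+ i * q ^+ j by ring.
have nz1 : qpoch_inf (a * q ^+ j) q != 0.
  by rewrite gt_eqF// qpoch_inf_gt0// scaled_expr_lt1.
have nz2 : qpoch_inf (g * q ^+ i) q != 0.
  by rewrite gt_eqF// qpoch_inf_gt0// scaled_expr_lt1.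
have nz3 : qpoch a q j != 0 by rewrite gt_eqF// qpoch_gt0.
have nz4 : qpoch (a * g * q ^+ i) q j != 0 by rewrite gt_eqF// qpoch_gt0.
by field; rewrite nz1 nz2 nz3 nz4.
Qed.

(** [jacobi_poly n d] is the little q-Jacobi polynomial of degree [n] when
    [d = a g q^(n-1)].  The parameter [d] is kept free because that exponent
    is negative for [n = 0]; the relation reads [d q = a g q^n]. *)
Definition jacobi_coef (n : nat) (d : R) (j : nat) : R :=
  qpoch q q n / q ^+ 'C(n, 2) *
  (qpoch d q j * q ^+ 'C(n - j, 2) /
   (qpoch q q (n - j) * (qpoch q q j * qpoch a q j))) * (-1) ^+ j.

Definition jacobi_poly (n : nat) (d : R) : {poly R} :=
  \sum_(j < n.+1) jacobi_coef n d j *: 'X^j.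

(** The factors [(a; q)_j] of the moments and of the coefficients cancel; what
    is left is the q-Chu-Vandermonde sum with [b = d] and
    [c = a g q^i]. *)
Lemma jackson_sum_jacobi_shifted n d i :
  jackson_sum (jacobi_poly n d * shifted_basis i) =
  moment_const i / qpoch (a * g * q ^+ i) q n *
  \prod_(k < n) (d - a * g * q ^+ i * q ^+ k).
Proof.
have agi : 0 <= a * g * q ^+ i < 1 by rewrite scaled_expr_lt1.
have qn0 k : qpoch q q k != 0 by rewrite gt_eqF// qpoch_gt0.
have an0 k : qpoch a q k != 0 by rewrite gt_eqF// qpoch_gt0.
have agn0 k : qpoch (a * g * q ^+ i) q k != 0 by rewrite gt_eqF// qpoch_gt0.
have C0 : q ^+ 'C(n, 2) != 0 by rewrite expf_neq0// gt_eqF.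
rewrite /jacobi_poly mulr_suml (big_morph _ jackson_sumD jackson_sum0).
apply: (mulfI (x := q ^+ 'C(n, 2) / qpoch q q n)).
  by rewrite mulf_neq0 ?invr_neq0.
rewrite [RHS](_ : _ = moment_const i / qpoch (a * g * q ^+ i) q n *
  (q ^+ 'C(n, 2) * (\prod_(k < n) (d - a * g * q ^+ i * q ^+ k)) /
    qpoch q q n)); last by ring.
rewrite -q_chu_vandermonde// !mulr_sumr; apply: eq_bigr => j _.
have jn : (j <= n)%N by rewrite -ltnS.
have -> : jacobi_coef n d j *: 'X^j * shifted_basis i =
          jacobi_coef n d j *: ('X^j * shifted_basis i) by rewrite scalerAl.
rewrite jackson_sumZ jackson_sum_moment /jacobi_coef.
have := qpochD (a * g * q ^+ i) q j (n - j); rewrite subnKC// => split_n.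
have nz : qpoch (a * g * q ^+ i * q ^+ j) q (n - j) != 0.
  by rewrite gt_eqF// qpoch_gt0// scaled_expr_lt1.
rewrite split_n; field.
by rewrite C0 !qn0 an0 agn0 nz.
Qed.

Section orthogonality.
Variables (n : nat) (d : R).
Hypothesis dE : d * q = a * g * q ^+ n.

(** The factor of index [k = n - 1 - i] of the product vanishes. *)
Lemma jackson_sum_jacobi_shifted_eq0 i : (i < n)%N ->
  jackson_sum (jacobi_poly n d * shifted_basis i) = 0.
Proof.
move=> lt_in; rewrite jackson_sum_jacobi_shifted.
have kn : (n - i.+1 < n)%N by rewrite ltn_subrL (leq_trans _ lt_in).
rewrite (bigD1 (Ordinal kn))//= [X in X * \prod_(_ | _) _](_ : _ = 0).
  by rewrite mul0r mulr0.
apply: (mulIf (x := q)); first by rewrite gt_eqF.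
rewrite mul0r mulrBl dE -mulrA -!mulrA -exprSr -exprD addnS -addSn.
by rewrite subnKC// subrr.
Qed.

Lemma jackson_sum_jacobi_lowdeg (p : {poly R}) : (size p <= n)%N ->
  jackson_sum (jacobi_poly n d * p) = 0.
Proof.
suff H m : (m <= n)%N -> forall r : {poly R}, (size r <= m)%N ->
    jackson_sum (jacobi_poly n d * r) = 0.
  exact: H (leqnn n) p.
elim: m => [_ r|m IHm lt_mn r sr].
  by rewrite size_poly_leq0 => /eqP ->; rewrite mulr0 jackson_sum0.
pose c := r`_m / (shifted_basis m)`_m.
have -> : r = (r - c *: shifted_basis m) + c *: shifted_basis m.
  by rewrite subrK.
rewrite mulrDr jackson_sumD -scalerAr jackson_sumZ.
rewrite jackson_sum_jacobi_shifted_eq0// mulr0 addr0.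
by apply: IHm; [exact: ltnW|exact: size_sub_shifted_basis].
Qed.

Lemma coef_jacobi_poly k d' j : (j <= k)%N ->
  (jacobi_poly k d')`_j = jacobi_coef k d' j.
Proof.
move=> jk; have jk1 : (j < k.+1)%N by [].
rewrite /jacobi_poly coef_sum (bigD1 (Ordinal jk1))//= coefZ coefXn eqxx mulr1.
rewrite big1 ?addr0// => l; rewrite -val_eqE /= => lj.
by rewrite coefZ coefXn eq_sym (negbTE lj) mulr0.
Qed.

Lemma size_jacobi_poly k d' : (size (jacobi_poly k d') <= k.+1)%N.
Proof.
apply: (leq_trans (size_sum _ _ _)); apply/bigmax_leqP => j _.
rewrite (leq_trans (size_scale_leq _ _))//.
by rewrite size_polyXn.
Qed.

(** Modulo lower degrees [p_n] is a multiple of [phi_n], the ratio being that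
    of the leading coefficients. *)
Lemma jackson_sum_jacobi_sqr : jackson_sum (jacobi_poly n d * jacobi_poly n d) =
  qpoch_inf q q * (qpoch d q n * qpoch_inf (a * g * q ^+ (n + n)) q) *
  qpoch q q n * a ^+ n /
  (qpoch_inf a q * qpoch_inf (g * q ^+ n) q * qpoch a q n).
Proof.
pose p := jacobi_poly n d.
pose c := p`_n / (shifted_basis n)`_n.
have -> : jackson_sum (p * p) = c * jackson_sum (p * shifted_basis n).
  rewrite -jackson_sumZ scalerAr.
  rewrite [X in jackson_sum (_ * X)](_ : _ =
    (p - c *: shifted_basis n) + c *: shifted_basis n); last by rewrite subrK.
  rewrite mulrDr jackson_sumD jackson_sum_jacobi_lowdeg ?add0r//.
  exact/size_sub_shifted_basis/size_jacobi_poly.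
have /andP[a0 a1] := a01. have /andP[g0 g1] := g01.
have agn : 0 <= a * g * q ^+ n < 1 by rewrite scaled_expr_lt1.
rewrite jackson_sum_jacobi_shifted /c coef_jacobi_poly//.
rewrite coef_shifted_basis /jacobi_coef.
rewrite subnn qpoch0 mul1r expr0 mulr1.
have prodE : \prod_(k < n) (d - a * g * q ^+ n * q ^+ k) = d ^+ n * qpoch q q n.
  rewrite /qpoch big_mkord -[in d ^+ n](card_ord n) -prodr_const -big_split /=.
  by apply: eq_bigr => k _; rewrite -dE; ring.
have dn : d ^+ n = a ^+ n * g ^+ n * q ^+ 'C(n, 2) * q ^+ 'C(n, 2).
  apply: (mulIf (x := q ^+ n)); first by rewrite expf_neq0// gt_eqF.
  by rewrite -exprMn dE !exprMn -exprM sqrn_bin2 !exprD; ring.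
rewrite prodE dn /moment_const (exprNn g).
rewrite (qpoch_infD q hq (a * g * q ^+ n) n) ?scaled_expr_lt1//.
have -> : a * g * q ^+ n * q ^+ n = a * g * q ^+ (n + n) by rewrite exprD mulrA.
have nz1 : qpoch_inf (g * q ^+ n) q != 0.
  by rewrite gt_eqF// qpoch_inf_gt0// scaled_expr_lt1.
have nz2 : qpoch (a * g * q ^+ n) q n != 0 by rewrite gt_eqF// qpoch_gt0.
have nz3 : qpoch a q n != 0 by rewrite gt_eqF// qpoch_gt0.
have nz4 : qpoch q q n != 0 by rewrite gt_eqF// qpoch_gt0.
have nz5 : qpoch_inf a q != 0 by rewrite gt_eqF// qpoch_inf_gt0.
have nz6 : g ^+ n != 0 by rewrite expf_neq0// gt_eqF.
have nz7 : q ^+ 'C(n, 2) != 0 by rewrite expf_neq0// gt_eqF.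
have nz8 : (-1) ^+ n != 0 :> R by rewrite signr_eq0.
by field; rewrite nz1 nz2 nz3 nz4 nz5 nz6 nz7 nz8.
Qed.

End orthogonality.
End functional.
End jackson.

(** * Angular integrals *)

Section angular.
Context {R : realType}.
Local Notation mu := (@lebesgue_measure R).
Local Open Scope complex_scope.

Lemma Rintegral_derivative (f F : R -> R) (a b : R) : a < b ->
  continuous f -> (forall x : R, is_derive x (1 : R) F (f x)) ->
  Rintegral mu `[a, b] f = F b - F a.
Proof.
move=> ab cf dF.
have cF : continuous F.
  move=> x; apply: differentiable_continuous; apply/derivable1_diffP.
  exact: ex_derive.
rewrite /Rintegral (@continuous_FTC2 _ f F)//.
- exact: continuous_subspaceT.
- split=> [x _||]; first exact: ex_derive.
    exact/cvg_at_right_filter/cF.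
  exact/cvg_at_left_filter/cF.
- by move=> x _; rewrite derive1E derive_val.
Qed.

Lemma continuous_cos_scaled (c : R) : continuous (fun x => cos (c * x)).
Proof.
move=> x; apply: (continuous_comp (f := fun y => c * y));
  last exact: continuous_cos.
exact: mulrl_continuous.
Qed.

Lemma continuous_sin_scaled (c : R) : continuous (fun x => sin (c * x)).
Proof.
move=> x; apply: (continuous_comp (f := fun y => c * y));
  last exact: continuous_sin.
exact: mulrl_continuous.
Qed.

Lemma sin_period (u v : nat) : sin ((u%:R - v%:R) * (2 * pi)) = 0 :> R.
Proof.
have per n : n%:R * (2 * pi) = 0 + (pi *+ 2) *+ n :> R.
  by rewrite add0r mulr_natl [2 * pi]mulr_natl.
rewrite mulrBl sinB !per !(periodicn (@sinD2pi R)) !(periodicn (@cosD2pi R)).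
by rewrite sin0; ring.
Qed.

Lemma cos_period (u v : nat) : cos ((u%:R - v%:R) * (2 * pi)) = 1 :> R.
Proof.
have per n : n%:R * (2 * pi) = 0 + (pi *+ 2) *+ n :> R.
  by rewrite add0r mulr_natl [2 * pi]mulr_natl.
rewrite mulrBl cosB !per !(periodicn (@sinD2pi R)) !(periodicn (@cosD2pi R)).
by rewrite sin0 cos0; ring.
Qed.

Lemma is_derive_scaled_comp (h : R -> R) (k e x dh : R) :
  is_derive (e * x) (1 : R) h dh ->
  is_derive x (1 : R) (fun y => k * h (e * y)) (k * (dh * e)).
Proof.
move=> dh_.
have scaled : is_derive x (1 : R) (fun y : R => e * y) e.
  apply: is_derive_eq (is_deriveZ e (is_derive_id x (1 : R))) _.
  exact: mulr1.
exact: is_deriveZ (is_derive1_comp dh_ scaled).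
Qed.

Lemma Rintegral_cos (c : R) (u v : nat) : u != v ->
  Rintegral mu `[0, 2 * pi] (fun x => c * cos ((u%:R - v%:R) * x)) = 0.
Proof.
move=> uv; set e : R := u%:R - v%:R.
have e0 : e != 0 by rewrite subr_eq0 eqr_nat.
have dF (x : R) :
    is_derive x (1 : R) (fun y => c / e * sin (e * y)) (c * cos (e * x)).
  apply: is_derive_eq (is_derive_scaled_comp _ _ _ _ _ (is_derive_sin _)) _.
  by field.
rewrite (@Rintegral_derivative _ _ _ _ _ _ dF).
- by rewrite mulr0 sin0 sin_period !mulr0 subrr.
- by rewrite mulr_gt0// pi_gt0.
- by move=> x; apply: (cvgM (cvg_cst c)); exact: continuous_cos_scaled.
Qed.

Lemma Rintegral_sin (c : R) (u v : nat) :
  Rintegral mu `[0, 2 * pi] (fun x => c * sin ((u%:R - v%:R) * x)) = 0.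
Proof.
set e : R := u%:R - v%:R; have [e0|e0] := eqVneq e 0.
  under eq_Rintegral do rewrite e0 mul0r sin0 mulr0.
  by rewrite Rintegral_cst// mul0r.
have dF (x : R) :
    is_derive x (1 : R) (fun y => - c / e * cos (e * y)) (c * sin (e * x)).
  apply: is_derive_eq (is_derive_scaled_comp _ _ _ _ _ (is_derive_cos _)) _.
  by field.
rewrite (@Rintegral_derivative _ _ _ _ _ _ dF).
- by rewrite mulr0 cos0 cos_period subrr.
- by rewrite mulr_gt0// pi_gt0.
- by move=> x; apply: (cvgM (cvg_cst c)); exact: continuous_sin_scaled.
Qed.

Lemma cintegrable_cis (c : R) (e : R) :
  cintegrable mu `[0, 2 * pi] (fun x => c%:C * cis (e * x)).
Proof.
split.
- rewrite (_ : (fun x => _) = EFin \o (fun x => c * cos (e * x))).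
    apply: continuous_compact_integrable; first exact: segment_compact.
    apply: continuous_subspaceT => x.
    by apply: (cvgM (cvg_cst c)); exact: continuous_cos_scaled.
  by apply/funext => x; rewrite /= mul0r subr0.
- rewrite (_ : (fun x => _) = EFin \o (fun x => c * sin (e * x))).
    apply: continuous_compact_integrable; first exact: segment_compact.
    apply: continuous_subspaceT => x.
    by apply: (cvgM (cvg_cst c)); exact: continuous_sin_scaled.
  by apply/funext => x; rewrite /= mul0r addr0.
Qed.

Lemma cintegral_cis (c : R) (u v : nat) :
  cintegral mu `[0, 2 * pi] (fun x => c%:C * cis ((u%:R - v%:R) * x)) =
  (2 * pi * c * (u == v)%:R)%:C.
Proof.
rewrite /cintegral.
under eq_Rintegral do rewrite /= mul0r subr0.
rewrite [X in _ +i* X](_ : _ = 0); last first.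
  by under eq_Rintegral do rewrite /= mul0r addr0; exact: Rintegral_sin.
have [<-|uv] := eqVneq u v; last by rewrite Rintegral_cos// mulr0.
under eq_Rintegral do rewrite subrr mul0r cos0 mulr1.
rewrite Rintegral_cst//= lebesgue_measure_itv /= lte_fin.
by rewrite mulr_gt0 ?pi_gt0// oppr0 addr0 mulr1 mulrC.
Qed.

End angular.

(** * Integration against the radial measure *)

Lemma EFin_lim_series {R : realType} (u : R ^nat) : cvgn (series u) ->
  (\sum_(k <oo) (u k)%:E)%E = (limn (series u))%:E.
Proof.
move=> cu; rewrite -EFin_lim//; congr (limn _); apply/funext => n.
by rewrite /= /series /= sumEFin.
Qed.

Section radial.
Context {R : realType}.
Variables (q c : R).
Hypotheses (hq : 0 < q < 1) (hc : -1 < c).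

Local Notation mu := (radial_measure hq hc).
Local Notation D := (`]0, +oo[ : set (measurableTypeR R)).
Local Notation w := (fun k => radial_weight q c (q ^+ k)).

Lemma ge0_integral_radial (f : R -> R) : measurable_fun D f ->
  (forall x, 0 <= f x) -> cvgn (series (fun k => w k * f (q ^+ k))) ->
  (\int[mu]_(x in D) (f x)%:E)%E =
  (limn (series (fun k => w k * f (q ^+ k))))%:E.
Proof.
move=> mf f0 cf; have mD : measurable D by exact: measurable_itv.
have mEf : measurable_fun D (fun x : measurableTypeR R => (f x)%:E).
  by exact/measurable_EFinP.
rewrite -EFin_lim_series// ge0_integral_measure_series//; last first.
  by move=> x _; rewrite lee_fin.
apply: eq_eseriesr => k _.
rewrite ge0_integral_mscale//; last by move=> x _; rewrite lee_fin.
rewrite integral_dirac// diracE mem_set ?mul1e//=.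
by rewrite in_itv/= andbT exprn_gt0//; case/andP: hq.
Qed.

Section summable.
Variable f : R -> R.
Hypotheses (mf : measurable_fun D f)
  (cf : cvgn (series (fun k => w k * `|f (q ^+ k)|))).

Let w0 k : 0 <= w k. Proof. exact: radial_weight_ge0. Qed.

Lemma integrable_radial :
  mu.-integrable D (fun x : measurableTypeR R => (f x)%:E).
Proof.
apply/integrableP; split; first exact/measurable_EFinP.
rewrite (_ : (fun x => _) = (fun x => (`|f x|)%:E)) //.
rewrite (ge0_integral_radial (fun x => `|f x|))// ?ltry//.
exact: measurableT_comp.
Qed.

Let cvg_part (g : R -> R) : (forall x, 0 <= g x <= `|f x|) ->
  cvgn (series (fun k => w k * g (q ^+ k))).
Proof.
move=> gf; apply: series_le_cvg cf => k.
- by rewrite mulr_ge0//; case/andP: (gf (q ^+ k)).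
- by rewrite mulr_ge0.
- by rewrite ler_wpM2l//; case/andP: (gf (q ^+ k)).
Qed.

Lemma Rintegral_radial :
  Rintegral mu D f = limn (series (fun k => w k * f (q ^+ k))).
Proof.
pose fp x := Num.max (f x) 0; pose fn x := Num.max (- f x) 0.
have fp_le x : 0 <= fp x <= `|f x|.
  by rewrite /fp le_max lexx orbT ge_max ler_norm normr_ge0.
have fn_le x : 0 <= fn x <= `|f x|.
  by rewrite /fn le_max lexx orbT ge_max -normrN ler_norm normr_ge0.
have mp : measurable_fun D fp by apply: measurable_maxr.
have mn : measurable_fun D fn.
  by apply: measurable_maxr => //; exact: measurableT_comp.
have cp := cvg_part _ fp_le. have cn := cvg_part _ fn_le.
rewrite /Rintegral integralE.
rewrite (_ : (fun x => (f x)%:E)^\+%E = (fun x => (fp x)%:E)); last first.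
  by apply/funext => x; rewrite funeposE EFin_max.
rewrite (_ : (fun x => (f x)%:E)^\-%E = (fun x => (fn x)%:E)); last first.
  by apply/funext => x; rewrite funenegE EFin_max.
rewrite (ge0_integral_radial fp)//; last by move=> x; case/andP: (fp_le x).
rewrite (ge0_integral_radial fn)//; last by move=> x; case/andP: (fn_le x).
rewrite -EFinB /= -lim_seriesB//; congr (limn (series _)); apply/funext => k /=.
rewrite -[LHS]mulrBr /fp /fn; congr (_ * _).
by case: (leP 0 (f (q ^+ k))) => h; case: leP => h'; lra.
Qed.

End summable.
End radial.

(** * The disc polynomials in polar coordinates *)

Definition gap (m n : nat) : nat := ((m - n) + (n - m))%N.

Lemma gap_eq (m n s t : nat) : (m + t = n + s)%N -> gap s t = gap m n.
Proof. by rewrite /gap; lia. Qed.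

Lemma minn_eq_diag (m n s t : nat) : (m + t = n + s)%N ->
  (minn m n == minn s t) = (m == s) && (n == t).
Proof. by lia. Qed.

Lemma gapE (R : realType) (m n : nat) : `|m%:R - n%:R| = (gap m n)%:R :> R.
Proof.
rewrite /gap; case: (leqP n m) => mn.
  by rewrite (eqP mn) addn0 -natrB// ger0_norm.
by rewrite (eqP (ltnW mn)) add0n distrC -(natrB _ (ltnW mn)) ger0_norm.
Qed.

Section disc.
Context {R : realType}.
Variable q : R.
Hypothesis hq : 0 < q < 1.
Local Open Scope complex_scope.

Let q0 : 0 < q. Proof. by case/andP: hq. Qed.
Let q1 : q < 1. Proof. by case/andP: hq. Qed.

Lemma powR_add (x y : R) : q `^ (x + y) = q `^ x * q `^ y.
Proof. by rewrite powRD// (gt_eqF q0) implybT. Qed.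

Lemma powR_nat (n : nat) : q `^ n%:R = q ^+ n.
Proof. by rewrite powR_mulrn// ltW. Qed.

Lemma powR_base1 : q `^ 1 = q.
Proof. by rewrite powRr1// ltW. Qed.

Lemma powR_01 (x : R) : 0 < x -> 0 < q `^ x < 1.
Proof.
move=> x0; rewrite powR_gt0//=.
have := gt0_ltr_powR x0 (x := q) (y := 1); rewrite powR1; apply=> //.
  by rewrite nnegrE ltW.
by rewrite nnegrE.
Qed.

(** [jacobi_poly] with the exponents of [q] as parameters. *)
Definition jacobi_exp_poly (n : nat) (al c : R) : {poly R} :=
  jacobi_poly q (q `^ (al + 1)) n (q `^ (al + c + n%:R + 1)).

Lemma little_qJacobiE n (al c x : R) :
  little_qJacobi q n al c x%:C = (jacobi_exp_poly n al c).[x]%:C.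
Proof.
rewrite /little_qJacobi /jacobi_exp_poly /jacobi_poly horner_sum rmorph_sum.
rewrite mulr_sumr big_rev_mkord subn0; apply: eq_bigr => j _.
have jn : (j <= n)%N by rewrite -ltnS.
rewrite subSS subKn// hornerZ hornerXn /jacobi_coef.
rewrite -(rmorphN (real_complex R)) -(rmorphXn (real_complex R)).
rewrite -!(rmorphM (real_complex R)) (exprNn x) /=; congr (_%:C).
by rewrite !mulrA.
Qed.

(** Both branches of [zeta_quotient] are the product of the same factors: in
    the generic one the factor of index [n] is cancelled by the
    denominator. *)
Lemma zetaE n (al c : R) : 0 < al + 1 -> 0 < c + 1 ->
  zeta q n al c =
  qpoch_inf q q * (qpoch (q `^ (al + c + n%:R + 1)) q n *
    qpoch_inf (q `^ (al + 1) * q `^ (c + 1) * q ^+ (n + n)) q) *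
  qpoch q q n * (q `^ (al + 1)) ^+ n /
  (qpoch_inf (q `^ (al + 1)) q * qpoch_inf (q `^ (c + 1) * q ^+ n) q *
   qpoch (q `^ (al + 1)) q n).
Proof.
move=> al0 c0; rewrite /zeta.
have last_base : q `^ (al + 1) * q `^ (c + 1) * q ^+ (n + n) =
    q `^ (al + c + 2 * n%:R + 2).
  by rewrite -powR_nat -!powR_add natrD; congr (_ `^ _); ring.
have -> : q `^ (c + n%:R + 1) = q `^ (c + 1) * q ^+ n.
  by rewrite -powR_nat -powR_add; congr (_ `^ _); ring.
have -> : q `^ (n%:R * (al + 1)) = (q `^ (al + 1)) ^+ n.
  by rewrite mulrC powRrM powR_mulrn// powR_ge0.
suff -> : zeta_quotient q n al c = qpoch (q `^ (al + c + n%:R + 1)) q n *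
    qpoch_inf (q `^ (al + 1) * q `^ (c + 1) * q ^+ (n + n)) q by [].
rewrite last_base /zeta_quotient; case: eqVneq => // nz.
have shift : q `^ (al + c + n%:R + 1) * q ^+ n.+1 =
    q `^ (al + c + 2 * n%:R + 2).
  by rewrite -powR_nat -powR_add; congr (_ `^ _); rewrite -natr1; ring.
have base : q `^ (al + c + n%:R + 1) * q ^+ n = q `^ (al + c + 2 * n%:R + 1).
  by rewrite -powR_nat -powR_add; congr (_ `^ _); ring.
rewrite (qpoch_infD q hq _ n.+1) shift; last first.
  suff /powR_01/andP[/ltW -> ->] : 0 < al + c + 2 * n%:R + 2 by [].
  by have := ler0n R n; lra.
rewrite qpochSr base mulrAC mulfK//.
by rewrite subr_eq0 eq_sym powR_eq1 (lt_eqF q1) (lt_gtF q0).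
Qed.

Lemma cisD (x y : R) : cis (x + y) = cis x * cis y.
Proof. by rewrite /cis cosD sinD; simpc; congr (_ +i* _); ring. Qed.

Lemma cis0 : cis 0 = 1 :> R[i].
Proof. by rewrite /cis cos0 sin0. Qed.

Lemma conjc_polar (r x : R) : conjc (r%:C * cis x) = r%:C * cis (- x).
Proof. by rewrite /cis cosN sinN; simpc. Qed.

Lemma cis_natmul n (x : R) : cis x ^+ n = cis (n%:R * x).
Proof.
elim: n => [|n IHn]; first by rewrite expr0 mul0r cis0.
by rewrite exprS IHn -cisD -natr1; congr cis; ring.
Qed.

Definition disc_profile (b c : R) (m n : nat) : {poly R} :=
  jacobi_exp_poly (minn m n) (b + (gap m n)%:R) c.

Lemma disc_poly_polar b c m n (r th : R) :
  let z := r%:C * cis th in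
  disc_poly q b c m n z (conjc z) =
  (r ^+ gap m n * (disc_profile b c m n).[r ^+ 2])%:C *
  cis ((m%:R - n%:R) * th).
Proof.
move=> z; rewrite /disc_profile; set k := gap m n.
have zz : z * conjc z = (r ^+ 2)%:C.
  rewrite /z conjc_polar mulrACA -cisD subrr.
  by rewrite cis0 mulr1 -(rmorphM (real_complex R)).
rewrite /disc_poly; case: leqP => mn.
  rewrite /disc_poly_ge zz little_qJacobiE.
  have kE : k = (m - n)%N by rewrite /k /gap; lia.
  rewrite kE (rmorphM (real_complex R)) (rmorphXn (real_complex R)).
  rewrite /z exprMn cis_natmul natrB//.
  by rewrite [LHS]mulrAC.
rewrite /disc_poly_ge mulrC [conjc z * z]mulrC zz little_qJacobiE.
have kE : k = (n - m)%N by rewrite /k /gap; lia.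
rewrite kE (rmorphM (real_complex R)) (rmorphXn (real_complex R)).
rewrite /z conjc_polar.
rewrite exprMn cis_natmul natrB ?(ltnW mn)//.
rewrite mulrCA mulrA; congr (_ * cis _); ring.
Qed.

(** * Orthogonality of the disc polynomials *)

Section orthogonality.
Variables (b c : R).
Hypotheses (hb : -1 < b) (hc : -1 < c).

Lemma jackson_sum_jacobi_exp_poly (k n n' : nat) :
  jackson_sum q (q `^ (b + k%:R + 1)) (q `^ (c + 1))
    (jacobi_exp_poly n (b + k%:R) c * jacobi_exp_poly n' (b + k%:R) c) =
  zeta q n (b + k%:R) c * (n == n')%:R.
Proof.
have al0 : 0 < b + k%:R + 1 by have := ler0n R k; move: hb; lra.
have c0 : 0 < c + 1 by move: hc; lra.
have a01 := powR_01 _ al0; have g01 := powR_01 _ c0.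
have dE m : q `^ (b + k%:R + c + m%:R + 1) * q =
    q `^ (b + k%:R + 1) * q `^ (c + 1) * q ^+ m.
  by rewrite -powR_nat -{2}powR_base1 -!powR_add; congr (_ `^ _); ring.
have ortho m m' : (m < m')%N ->
    jackson_sum q (q `^ (b + k%:R + 1)) (q `^ (c + 1))
      (jacobi_exp_poly m' (b + k%:R) c * jacobi_exp_poly m (b + k%:R) c) = 0.
  move=> mm; apply: (jackson_sum_jacobi_lowdeg q hq _ _ a01 g01 _ _ (dE m')).
  exact: leq_trans (size_jacobi_poly _ _ _ _) mm.
case: (ltngtP n n') => [lt|lt|<-].
- by rewrite mulrC ortho// mulr0.
- by rewrite ortho// mulr0.
by rewrite mulr1 zetaE// (jackson_sum_jacobi_sqr q hq _ _ a01 g01 _ _ (dE n)).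
Qed.

Variables (m n s t : nat).
Let F := fun z : R[i] =>
    disc_poly q b c m n z (conjc z) * conjc (disc_poly q b c s t z (conjc z)).
Let P := disc_profile b c m n.
Let P' := disc_profile b c s t.
Let radial (r : R) := r ^+ gap m n * P.[r ^+ 2] * (r ^+ gap s t * P'.[r ^+ 2]).

Lemma disc_product_polar r th : F (r%:C * cis th) =
  (radial r)%:C * cis (((m + t)%:R - (n + s)%:R) * th).
Proof.
rewrite /F !disc_poly_polar conjc_polar mulrACA -cisD.
rewrite -(rmorphM (real_complex R)) [(m + t)%:R]natrD [(n + s)%:R]natrD.
by congr (_ * cis _); ring.
Qed.

Lemma angular_mean_disc r :
  angular_mean F r = (radial r * (m + t == n + s)%N%:R)%:C.
Proof.
rewrite /angular_mean.
have -> : (fun th => F (r%:C * cis th)) =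
    (fun th => (radial r)%:C * cis (((m + t)%:R - (n + s)%:R) * th)).
  by apply/funext => th; exact: disc_product_polar.
rewrite cintegral_cis -(rmorphM (real_complex R)); congr (_%:C).
have pi0 : pi != 0 :> R by rewrite gt_eqF// pi_gt0.
by move: (@pi R) pi0 => p p0; field.
Qed.

(** The two powers of [r] combine into [x^|m-n|]: the indicator makes
    [gap s t] equal to [gap m n] whenever it is nonzero. *)
Definition disc_integrand (x : R) : R :=
  x ^+ gap m n * (P * P').[x] * (m + t == n + s)%N%:R * x `^ b.

Lemma disc_integrandE (x : R) : 0 < x ->
  angular_mean F (Num.sqrt x) * (x `^ b)%:C = (disc_integrand x)%:C.
Proof.
move=> x0; rewrite angular_mean_disc -(rmorphM (real_complex R)).
congr (_%:C); rewrite /disc_integrand /radial.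
have [e|_] := eqVneq; last by rewrite !mulr0 !mul0r.
rewrite (gap_eq _ _ _ _ e) sqr_sqrtr ?(ltW x0)// hornerM.
rewrite -[in x ^+ _](sqr_sqrtr (ltW x0)).
by rewrite -exprM mul2n -addnn exprD; ring.
Qed.

Lemma measurable_disc_integrand (D : set (measurableTypeR R)) :
  measurable_fun D disc_integrand.
Proof.
apply: measurable_funM; last exact: measurable_funTS.
apply: measurable_funM => //; apply: measurable_funM.
  exact: measurable_funX.
apply: measurable_funTS; apply: continuous_measurable_fun.
exact: continuous_horner.
Qed.

Let a := q `^ (b + (gap m n)%:R + 1).
Let g := q `^ (c + 1).

Lemma radial_weight_disc j :
  radial_weight q c (q ^+ j) * disc_integrand (q ^+ j) =
  jackson_term q a g (P * P') j * (m + t == n + s)%N%:R.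
Proof.
rewrite /radial_weight /jackson_term /mass /disc_integrand.
have -> : a ^+ j = q ^+ j * (q ^+ j) ^+ gap m n * (q ^+ j) `^ b.
  rewrite /a !powR_add powR_base1 powR_nat !exprMn -!exprM.
  rewrite [(gap m n * j)%N]mulnC -[in (q ^+ j) `^ b]powR_nat -powRrM.
  rewrite [_%:R * b]mulrC powRrM.
  by rewrite [(q `^ b) `^ _]powR_mulrn ?powR_ge0//; ring.
by ring.
Qed.

Lemma is_cvg_disc_integrand : cvgn (series (fun j =>
  radial_weight q c (q ^+ j) * `|disc_integrand (q ^+ j)|)).
Proof.
have a01 : 0 < a < 1.
  by apply: powR_01; have := ler0n R (gap m n); move: hb; lra.
have g01 : 0 < g < 1 by apply: powR_01; move: hc; lra.
rewrite (_ : (fun j => _) = (m + t == n + s)%N%:R *: (fun j =>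
    `|jackson_term q a g (P * P') j|)).
  exact/is_cvg_seriesZ/is_cvg_norm_jackson_term.
apply/funext => j; rewrite -[X in X * _]ger0_norm ?radial_weight_ge0//.
by rewrite -normrM radial_weight_disc normrM normr_nat mulrC.
Qed.

Lemma lim_disc_integrand :
  limn (series (fun j =>
    radial_weight q c (q ^+ j) * disc_integrand (q ^+ j))) =
  zeta q (minn m n) (`|m%:R - n%:R| + b) c * (m == s)%:R * (n == t)%:R.
Proof.
have [e|ne] := eqVneq (m + t)%N (n + s)%N; last first.
  rewrite (_ : (fun j => _) = (fun=> 0)); last first.
    by apply/funext => j; rewrite radial_weight_disc (negbTE ne) mulr0.
  rewrite (_ : series _ = cst 0) ?lim_cst//; last first.
    by apply/funext => N; rewrite /series /= big1.
  have : (m == s) && (n == t) = false.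
    apply/negbTE; apply: contra_neqN ne => /andP[/eqP-> /eqP->].
    by rewrite addnC.
  by case: (m == s) => /= [->|_]; rewrite !mulr0 ?mul0r.
rewrite (_ : (fun j => _) = jackson_term q a g (P * P')); last first.
  by apply/funext => j; rewrite radial_weight_disc e eqxx mulr1.
rewrite -/(jackson_sum _ _ _ _) /P' /disc_profile (gap_eq _ _ _ _ e).
rewrite jackson_sum_jacobi_exp_poly// gapE addrC -mulrA -natrM mulnb.
by rewrite (minn_eq_diag _ _ _ _ e).
Qed.

End orthogonality.
End disc.

Theorem theorem6p1 (R : realType) (q : R) (hq : 0 < q < 1)
    (beta gamma : R) (hbeta : -1 < beta) (hgamma : -1 < gamma)
    (m n s t : nat) :
  let F := fun z : R[i] =>
    disc_poly q beta gamma m n z (conjc z) *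
    conjc (disc_poly q beta gamma s t z (conjc z)) in
  polar_integrable (radial_measure hq hgamma) beta F /\
  polar_integral (radial_measure hq hgamma) beta F =
    (zeta q (minn m n) (`|m%:R - n%:R| + beta) gamma
       * (m == s)%:R * (n == t)%:R)%:C%C.
Proof.
move=> F; pose h := disc_integrand q beta gamma m n s t.
pose D : set (measurableTypeR R) := `]0, +oo[.
have hE (x : R) : x \in D ->
    angular_mean F (Num.sqrt x) * (x `^ beta)%:C%C = (h x)%:C%C.
  move=> /set_mem; rewrite /D /= in_itv /= andbT => x0.
  exact: disc_integrandE.
have re_h (x : R) : x \in D ->
    complex.Re (angular_mean F (Num.sqrt x) * (x `^ beta)%:C%C) = h x.
  by move=> /hE ->.
have im_0 (x : R) : x \in D ->
    complex.Im (angular_mean F (Num.sqrt x) * (x `^ beta)%:C%C) = 0.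
  by move=> /hE ->.
have mh := measurable_disc_integrand q beta gamma m n s t D.
have cvgh := is_cvg_disc_integrand q hq _ _ hbeta hgamma m n s t.
split; first split.
- move=> x x0.
  have [r Fr] : exists r, (fun th => F ((Num.sqrt x)%:C%C * cis th)) =
      (fun th => r%:C%C * cis (((m + t)%:R - (n + s)%:R) * th)).
    by eexists; apply/funext => th; exact: disc_product_polar.
  by rewrite Fr; exact: cintegrable_cis.
- split.
    apply: eq_integrable (integrable_radial _ _ hq hgamma _ mh cvgh) => //.
    by move=> x /re_h ->.
  apply: eq_integrable (integrable0 _ _) => //.
  by move=> x /im_0 ->.
rewrite /polar_integral /cintegral.
transitivity (Complex (Rintegral (radial_measure hq hgamma) D h)
    (Rintegral (radial_measure hq hgamma) D (fun=> 0))).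
  by congr Complex; apply: eq_Rintegral.
rewrite (Rintegral_radial _ _ hq hgamma _ mh cvgh) lim_disc_integrand//.
by rewrite [X in Complex _ X](_ : _ = 0)// /Rintegral integral0.
Qed.
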